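(* Suppose that $f\in AP(\mathbb{R},\mathbb{R})$, $u\in AP(\mathbb{Z},\mathbb{R})$ and $\{\tau_j\}_{j\in\mathbb{Z}}$ is a Wexler sequence. Then the function $h:\mathbb{R}\to\mathbb{R}$ defined by $$h(t)=f(t)\cdot u(n),\quad \tau_n<t\le\tau_{n+1},\ n\in\mathbb{Z},$$ is piecewise continuous almost periodic, i.e. $h\in PCAP(\mathbb{R},\mathbb{R})$.
   Context: Let $\mathbb{G}=\mathbb{R}$ or $\mathbb{Z}$. A subset $S\subset\mathbb{G}$ is relatively dense if there is a positive $l\in\mathbb{G}$ such that $[a,a+l]\cap S\neq\emptyset$ for all $a\in\mathbb{G}$. A continuous function $f:\mathbb{G}\to\mathbb{R}$ is Bohr almost periodic if for every $\epsilon>0$ the set $T(f,\epsilon)=\{\tau\in\mathbb{G}: |f(t+\tau)-f(t)|<\epsilon\ \forall t\in\mathbb{G}\}$ is relatively dense; $AP(\mathbb{G},\mathbb{R})$ is the set of all such functions (every function on $\mathbb{Z}$ is regarded as continuous). A sequence $\{\tau_j\}_{j\in\mathbb{Z}}\subset\mathbb{R}$ is admissible if $\tau_j<\tau_{j+1}$ for all $j$ and $\lim_{j\to\pm\infty}\tau_j=\pm\infty$. Put $\tau_j^k=\tau_{j+k}-\tau_j$ for $j,k\in\mathbb{Z}$. The family $\{\{\tau_j^k\}_{j\in\mathbb{Z}}\}_{k\in\mathbb{Z}}$ is equi-potentially almost periodic if for each $\epsilon>0$ the set $\{p\in\mathbb{Z}: |\tau_{j+p}^k-\tau_j^k|<\epsilon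 \text{ for all } j,k\in\mathbb{Z}\}$ is relatively dense in $\mathbb{Z}$. A Wexler sequence is an admissible sequence with $\inf_{j\in\mathbb{Z}}\tau_j^1>0$ for which this family is equi-potentially almost periodic. $PC(\mathbb{R},\mathbb{R})$ is the set of functions $h:\mathbb{R}\to\mathbb{R}$ which have discontinuities, all of the first kind (finite one-sided limits exist), only at the points of a subset (possibly empty) of some admissible sequence $\{\tau_j\}$, and are continuous from the left at each $\tau_j$. A function $h\in PC(\mathbb{R},\mathbb{R})$ is piecewise continuous almost periodic (p.c.a.p.), written $h\in PCAP(\mathbb{R},\mathbb{R})$, if: (i) there is an admissible sequence $\{\tau_j\}_{j\in\mathbb{Z}}$ containing the possible discontinuities of $h$ such that the family $\{\{\tau_j^k\}_{j}\}_{k}$ is equi-potentially almost periodic; (ii) for each $\epsilon>0$ there is $\delta>0$ such that $|h(s)-h(t)|<\epsilon$ whenever $s,t\in(\tau_j,\tau_{j+1}]$ for some $j\in\mathbb{Z}$ and $|s-t|<\delta$; (iii) for each $\epsilon>0$ the set $T(h,\epsilon)=\{\tau\in\mathbb{R}: |h(t+\tau)-h(t)|<\epsilon$ for all $t\in\mathbb{R}$ such that $|t-\tau_j|>\epsilon$ for all $j\in\mathbb{Z}\}$ is relatively dense in $\mathbb{R}$. When $h$ is said to have discontinuities at the points of a subset of a given sequence $\{\tau_j\}$, that sequence is the one used in (i)-(iii). *)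

(* Defs.v *)
From HB Require Import structures.
From mathcomp Require Import all_boot all_order all_algebra.
From mathcomp Require Import all_classical all_reals all_analysis.
Set Implicit Arguments.
Unset Strict Implicit.
Unset Printing Implicit Defensive.
Import Order.TTheory GRing.Theory Num.Theory.
Import numFieldNormedType.Exports.
Local Open Scope classical_set_scope.
Local Open Scope ring_scope.

(* The index group G stands for both R and int. *)
Definition relatively_dense (G : numDomainType) (S : set G) : Prop :=
  exists l : G, 0 < l /\ forall a : G, `[a, a + l] `&` S !=set0.

Definition almost_periods (R : realType) (G : numDomainType)
    (f : G -> R) (eps : R) : set G :=
  [set tau | forall t : G, `|f (t + tau) - f t| < eps].

Definition bohr_ap_real (R : realType) (f : R -> R) : Prop :=
  continuous f /\
  forall eps : R, 0 < eps -> relatively_dense (almost_periods f eps).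

(* int carries its discrete topology: continuity is no condition. *)
Definition bohr_ap_int (R : realType) (u : int -> R) : Prop :=
  forall eps : R, 0 < eps -> relatively_dense (almost_periods u eps).

(* The last two clauses are lim_{j -> +oo} tau_j = +oo and
   lim_{j -> -oo} tau_j = -oo, int having no filters at infinity. *)
Definition admissible (R : realType) (tau : int -> R) : Prop :=
  [/\ forall j : int, tau j < tau (j + 1),
      forall A : R, exists J : int, forall j : int, J <= j -> A < tau j
    & forall A : R, exists J : int, forall j : int, j <= J -> tau j < A].

(* tau_j^k *)
Definition tau_diff (R : realType) (tau : int -> R) (k j : int) : R :=
  tau (j + k) - tau j.

Definition equipotentially_ap (R : realType) (tau : int -> R) : Prop :=
  forall eps : R, 0 < eps ->
    relatively_dense
      [set p : int | forall j k : int,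
         `|tau_diff tau k (j + p) - tau_diff tau k j| < eps].

(* The real-valued inf is the genuine infimum here: for admissible tau, the set
   of gaps is nonempty and bounded below by 0. *)
Definition wexler (R : realType) (tau : int -> R) : Prop :=
  [/\ admissible tau,
      0 < inf (range (tau_diff tau 1))
    & equipotentially_ap tau].

Definition discontinuities (R : realType) (h : R -> R) : set R :=
  [set t | ~ {for t, continuous h}].

Definition PC (R : realType) (h : R -> R) : Prop :=
  exists tau : int -> R,
    [/\ admissible tau,
        discontinuities h `<=` range tau,
        (forall t : R, discontinuities h t ->
           cvg (h x @[x --> t^'-]) /\ cvg (h x @[x --> t^'+]))
      & forall j : int, h x @[x --> (tau j)^'-] --> h (tau j)].

Definition pc_almost_periods (R : realType) (tau : int -> R) (h : R -> R)
    (eps : R) : set R :=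
  [set r | forall t : R, (forall j : int, eps < `|t - tau j|) ->
     `|h (t + r) - h t| < eps].

(* h is p.c.a.p., with tau the sequence used in conditions (i)-(iii). *)
Definition PCAP_along (R : realType) (tau : int -> R) (h : R -> R) : Prop :=
  PC h /\
  [/\ [/\ admissible tau, discontinuities h `<=` range tau
        & equipotentially_ap tau],
      (forall eps : R, 0 < eps ->
         exists delta : R, 0 < delta /\
           forall (j : int) (s t : R),
             s \in `]tau j, tau (j + 1)] -> t \in `]tau j, tau (j + 1)] ->
             `|s - t| < delta -> `|h s - h t| < eps)
    & forall eps : R, 0 < eps ->
        relatively_dense (pc_almost_periods tau h eps)].

Definition PCAP (R : realType) (h : R -> R) : Prop :=
  exists tau : int -> R, PCAP_along tau h.

(* Main.v *)
Require Import Defs.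
From HB Require Import structures.
From mathcomp Require Import all_boot all_order all_algebra.
From mathcomp Require Import all_classical all_reals all_analysis.
From mathcomp Require Import lra zify.
Set Implicit Arguments.
Unset Strict Implicit.
Unset Printing Implicit Defensive.
Import Order.TTheory GRing.Theory Num.Theory.
Import numFieldNormedType.Exports.
Local Open Scope classical_set_scope.
Local Open Scope ring_scope.

(** The function h has one-sided limits at the tau j, and it is uniformly
    continuous on the pieces, uniformly over all pieces, because f is bounded and
    uniformly continuous and u is bounded. The real content is that its almost
    periods are relatively dense.

    For this, f, u and tau need common almost periods: a real r and an integer
    q such that f is almost r-periodic, u is almost q-periodic, and
    tau (j + q) - tau j is almost r for every j ([common_almost_periods]).
    When t is at distance more than eps from all the tau j and lies between
    tau n and tau (n + 1), the point t + r then lies between tau (n + q) and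
    tau (n + q + 1), so that h (t + r) = f (t + r) * u (n + q) is close to
    h t = f t * u n.

    Common almost periods come from Bochner's characterization of almost
    periodicity by total boundedness of the set of translates, here in the form
    of finite colorings: for every eps the integers p can be colored with
    finitely many colors so that the translates u(. + p) of two integers of the
    same color are eps-close ([bohr_ap_int_colorable]); likewise for
    the translates of the differences of tau
    ([equipotentially_ap_colorable]), and for f(. + tau p)
    ([bohr_ap_real_colorable]). Take the product of the three colorings. If p
    and p' have the same color, q = p - p' and r = tau p - tau p' are as
    required. Choosing one p' per color, only finitely many numbers tau p' are
    subtracted, while the tau p meet every interval of some fixed length because
    the gaps of tau are bounded; hence these r are relatively dense. *)

(** * Finite colorings *)

Lemma relatively_dense_sub (G : numDomainType) (S S' : set G) :
  S `<=` S' -> relatively_dense S -> relatively_dense S'.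
Proof.
move=> SS' [l [l0 H]]; exists l; split=> // a.
by have [s [sal Ss]] := H a; exists s; split=> //; exact: SS'.
Qed.

(** The index set I splits into finitely many classes, any two members of a class
    being related by E. When E i j says that the i-th and j-th points of a metric
    space are at distance less than eps, and eps varies, this is total
    boundedness of the family. Unlike the existence of a finite eps-net, it is
    stable under conjunction and reindexing with no loss on eps. *)
Definition finitely_colorable (I : Type) (E : I -> I -> Prop) : Prop :=
  exists (T : finType) (c : I -> T), forall i j, c i = c j -> E i j.

Lemma finitely_colorable_sub (I : Type) (E E' : I -> I -> Prop) :
  (forall i j, E i j -> E' i j) ->
  finitely_colorable E -> finitely_colorable E'.
Proof. by move=> EE' [T [c H]]; exists T, c => i j /H /EE'. Qed.

Lemma finitely_colorableI (I : Type) (E E' : I -> I -> Prop) :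
  finitely_colorable E -> finitely_colorable E' ->
  finitely_colorable (fun i j => E i j /\ E' i j).
Proof.
move=> [T [c H]] [T' [c' H']].
exists (T * T')%type, (fun i => (c i, c' i)) => i j [ij ij'].
by split; [exact: H|exact: H'].
Qed.

Lemma finitely_colorable_comp (I J : Type) (g : J -> I) (E : I -> I -> Prop) :
  finitely_colorable E -> finitely_colorable (fun i j => E (g i) (g j)).
Proof. by move=> [T [c H]]; exists T, (c \o g) => i j; exact: H. Qed.

(** One representative is chosen per color; the default index i0 serves the
    colors that are not used. *)
Lemma finitely_colorable_net (I : Type) (E : I -> I -> Prop) (i0 : I) :
  finitely_colorable E ->
  exists (T : finType) (r : T -> I), forall i, exists k, E i (r k).
Proof.
move=> [T [c H]].
have /choice[r Hr] : forall k : T, exists i, (exists j, c j = k) -> c i = k.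
  move=> k; have [[j cj]|nk] := pselect (exists j, c j = k); first by exists j.
  by exists i0 => /nk.
by exists T, r => i; exists (c i); apply: H; rewrite Hr//; exists i.
Qed.

Lemma ler_norm_sum_term (R : numDomainType) (T : finType) (F : T -> R) (k : T) :
  `|F k| <= \sum_i `|F i|.
Proof. by rewrite (bigD1 k)//= lerDl sumr_ge0. Qed.

Lemma finitely_colorable_bounded (R : realType) (I : Type) (g : I -> R) (i0 : I) :
  finitely_colorable (fun i j => `|g i - g j| < 1) ->
  exists2 B : R, 0 < B & forall i, `|g i| <= B.
Proof.
move=> /(finitely_colorable_net i0)[T [r H]].
exists (1 + \sum_k `|g (r k)|).
  by rewrite ltr_pwDl// sumr_ge0.
move=> i; have [k /ltW ik] := H i.
rewrite -(subrK (g (r k)) (g i)) (le_trans (ler_normD _ _))// lerD//.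
exact: (ler_norm_sum_term (g \o r)).
Qed.

(** * Relatively dense sets give finite colorings *)

(** Every p is moved into the finite window [0, l] by adding an element of S;
    its color is the point reached. *)
Lemma relatively_dense_colorable_int (S : set int) : relatively_dense S ->
  finitely_colorable (fun p q : int =>
    exists s s', [/\ S s, S s' & p + s = q + s']).
Proof.
move=> [l [l0 H]].
have /choice[s Hs] : forall p : int, exists s, S s /\ (0 <= p + s <= l).
  move=> p; have [s []] := H (- p); rewrite /= in_itv/= => /andP[? ?] Ss.
  by exists s; split=> //; apply/andP; split; lia.
exists (ordinal (absz l).+1), (fun p : int => inord (absz (p + s p))) => p q.
move=> /(congr1 (@nat_of_ord _)).
have [Sp /andP[? ?]] := Hs p; have [Sq /andP[? ?]] := Hs q.
rewrite !inordK; [|lia..] => ?.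
by exists (s p), (s q); split=> //; lia.
Qed.

(** As for the integers, but the color is the index of the cell of length d of
    the window [0, l] that contains the point reached. *)
Lemma relatively_dense_colorable_real (R : realType) (S : set R) (d : R) :
  0 < d -> relatively_dense S ->
  finitely_colorable (fun x y : R =>
    exists s s', [/\ S s, S s' & `|(x + s) - (y + s')| < d]).
Proof.
move=> d0 [l [l0 H]].
have /choice[s Hs] : forall x : R, exists s, S s /\ (0 <= x + s <= l).
  move=> x; have [s []] := H (- x); rewrite /= in_itv/= => /andP[? ?] Ss.
  by exists s; split=> //; apply/andP; split; lra.
pose c x := Num.truncn ((x + s x) / d).
have cP x : (c x)%:R <= (x + s x) / d < (c x).+1%:R.
  have [_ /andP[? _]] := Hs x.
  by apply: truncn_itv; rewrite divr_ge0// ltW.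
have cle x : (c x < (Num.truncn (l / d)).+1)%N.
  have [_ /andP[? xl]] := Hs x; rewrite ltnS le_truncn//.
  by rewrite ler_pM2r// invr_gt0.
exists 'I_((Num.truncn (l / d)).+1), (fun x => inord (c x)) => x y.
move=> /(congr1 (@nat_of_ord _)); rewrite !inordK// => cxy.
have [Sx _] := Hs x; have [Sy _] := Hs y.
exists (s x), (s y); split=> //.
have := cP x; have := cP y; rewrite -cxy -natr1.
rewrite !ler_pdivlMr// !ltr_pdivrMr// => /andP[? ?] /andP[? ?].
by rewrite ltr_norml; apply/andP; split; lra.
Qed.

(** * Almost periodic functions and sequences *)

(** Heine's theorem on [a, b]; only x, and not y, is required to lie in the
    segment. *)
Lemma continuous_segment_unif (R : realType) (f : R -> R) (a b e : R) :
  continuous f -> 0 < e ->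
  exists2 d, 0 < d & forall x y, a <= x <= b -> `|x - y| < d ->
    `|f x - f y| < e.
Proof.
move=> fc e0.
have := @segment_compact R a b; rewrite compact_near_coveringP => cov.
(* The covering property of [a, b] is used with the filter of small d > 0. *)
have := cov R (0^'+) (fun d x => forall y, `|x - y| < d -> `|f x - f y| < e) _.
case.
  move=> x _.
  have e20 : 0 < e / 2 by lra.
  have /cvgrPdist_lt /(_ _ e20) := fc x.
  move=> /nbhs_ballP[r /= r0 Hr].
  have r20 : 0 < r / 2 by lra.
  exists (ball x (r / 2), [set d | d < r / 2]) => /=.
    split; first exact: nbhsx_ballx.
    exact: nbhs_right_lt.
  move=> [z d] /= [zx dr] y zy.
  move: zx; rewrite /ball/= => zx.
  have /Hr fz : ball x r z by rewrite /ball/=; lra.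
  have /Hr fy : ball x r y.
    by rewrite /ball/= (le_lt_trans (ler_distD z _ _))//; lra.
  rewrite /= in fz fy.
  rewrite (le_lt_trans (ler_distD (f x) _ _))// distrC.
  lra.
move=> r r0 Hr; exists (r / 2); first exact: divr_gt0.
move=> x y xab; apply: Hr; last by rewrite /= in_itv.
  by rewrite /ball_ /= sub0r normrN gtr0_norm; move: r0 => /=; lra.
by rewrite divr_gt0.
Qed.

Lemma bohr_ap_unif_continuous (R : realType) (f : R -> R) (e : R) :
  bohr_ap_real f -> 0 < e ->
  exists2 d, 0 < d & forall x y, `|x - y| < d -> `|f x - f y| < e.
Proof.
move=> [fc fap] e0.
have e30 : 0 < e / 3 by lra.
have [l [l0 H]] := fap _ e30.
have [d d0 Hd] := continuous_segment_unif 0 l fc e30.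
exists d => // x y xy.
(* An almost period s brings x into [0, l]. *)
have [s []] := H (- x); rewrite /= in_itv/= => /andP[? ?] Ss.
have xs : 0 <= x + s <= l by apply/andP; split; lra.
have := Hd (x + s) (y + s) xs.
rewrite opprD addrACA subrr addr0 => /(_ xy).
have := Ss x; have := Ss y.
rewrite !ltr_norml => /andP[? ?] /andP[? ?] /andP[? ?].
by apply/andP; split; lra.
Qed.

(** The translates of a Bohr almost periodic function are totally bounded for the
    uniform distance. *)
Lemma bohr_ap_real_colorable (R : realType) (f : R -> R) (e : R) :
  bohr_ap_real f -> 0 < e ->
  finitely_colorable (fun x y : R => forall t, `|f (t + x) - f (t + y)| < e).
Proof.
move=> fap e0.
have e30 : 0 < e / 3 by lra.
have [d d0 Hd] := bohr_ap_unif_continuous fap e30.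
have := relatively_dense_colorable_real d0 (fap.2 _ e30).
apply: finitely_colorable_sub => x y [s [s' [Ss Ss' xy]]] t.
have := Ss (t + x); have := Ss' (t + y).
have /Hd : `|(t + x + s) - (t + y + s')| < d.
  by have -> : t + x + s - (t + y + s') = x + s - (y + s') by lra.
rewrite !ltr_norml => /andP[? ?] /andP[? ?] /andP[? ?].
by apply/andP; split; lra.
Qed.

(** Total boundedness of the translates, uniformly over a family of sequences
    indexed by K with common almost periods. *)
Lemma equi_ap_int_colorable (R : realType) (K : Type) (g : K -> int -> R)
    (e : R) : 0 < e ->
  (forall eps, 0 < eps -> relatively_dense
     [set p : int | forall k n, `|g k (n + p) - g k n| < eps]) ->
  finitely_colorable
    (fun p q : int => forall k n, `|g k (n + p) - g k (n + q)| < e).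
Proof.
move=> e0 gap.
have e20 : 0 < e / 2 by lra.
have := relatively_dense_colorable_int (gap _ e20).
apply: finitely_colorable_sub => p q [s [s' [Ss Ss' pq]]] k n.
have := Ss k (n + p); have := Ss' k (n + q).
rewrite -!addrA pq !ltr_norml => /andP[? ?] /andP[? ?].
by apply/andP; split; lra.
Qed.

Lemma bohr_ap_int_colorable (R : realType) (u : int -> R) (e : R) :
  bohr_ap_int u -> 0 < e ->
  finitely_colorable (fun p q : int => forall n, `|u (n + p) - u (n + q)| < e).
Proof.
move=> uap e0.
apply: (finitely_colorable_sub (fun p q H => H tt)).
apply: (@equi_ap_int_colorable R unit (fun=> u) e e0) => eps /uap.
by apply: relatively_dense_sub => p Hp _; exact: Hp.
Qed.

Lemma equipotentially_ap_colorable (R : realType) (tau : int -> R) (e : R) :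
  equipotentially_ap tau -> 0 < e ->
  finitely_colorable (fun p q : int =>
    forall k j, `|tau_diff tau k (j + p) - tau_diff tau k (j + q)| < e).
Proof.
move=> tauap e0; apply: equi_ap_int_colorable => // eps /tauap.
by apply: relatively_dense_sub => p Hp k j; exact: Hp.
Qed.

Lemma bohr_ap_real_bounded (R : realType) (f : R -> R) : bohr_ap_real f ->
  exists2 B : R, 0 < B & forall t, `|f t| <= B.
Proof.
move=> /bohr_ap_real_colorable/(_ ltr01) H.
apply: (finitely_colorable_bounded 0).
by apply: finitely_colorable_sub H => x y /(_ 0); rewrite !add0r.
Qed.

Lemma bohr_ap_int_bounded (R : realType) (u : int -> R) : bohr_ap_int u ->
  exists2 B : R, 0 < B & forall n, `|u n| <= B.
Proof.
move=> /bohr_ap_int_colorable/(_ ltr01) H.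
apply: (finitely_colorable_bounded 0).
by apply: finitely_colorable_sub H => x y /(_ 0); rewrite !add0r.
Qed.

Lemma equipotentially_ap_gap_bounded (R : realType) (tau : int -> R) :
  equipotentially_ap tau ->
  exists2 B : R, 0 < B & forall n, `|tau (n + 1) - tau n| <= B.
Proof.
move=> /equipotentially_ap_colorable/(_ ltr01) H.
apply: (finitely_colorable_bounded 0).
by apply: finitely_colorable_sub H => x y /(_ 1 0); rewrite !add0r.
Qed.

(** * Common almost periods *)

Lemma admissible_locate (R : realType) (tau : int -> R) (t : R) :
  admissible tau -> exists n, tau n < t <= tau (n + 1).
Proof.
move=> [_ taupinf tauninf].
have [J1 H1] := tauninf t; have [J2 H2] := taupinf t.
(* n = J1 + k for the least natural number k with t <= tau (J1 + k + 1). *)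
have ex : exists k : nat, t <= tau (J1 + k%:Z + 1).
  by exists (absz (J2 - J1)); apply/ltW/H2; lia.
case: (ex_minnP ex) => -[|k] tk kmin.
  by exists J1; rewrite H1//= -[X in tau (X + 1)]addr0.
exists (J1 + k.+1%:Z); rewrite tk andbT ltNge; apply/negP => tk'.
have /kmin : t <= tau (J1 + k%:Z + 1) by rewrite -addrA -PoszD addn1.
by rewrite ltnn.
Qed.

(** The last clause says that tau is shifted by about r when its index is shifted
    by q. *)
Lemma common_almost_periods (R : realType) (f : R -> R) (u tau : int -> R)
    (e : R) :
  bohr_ap_real f -> bohr_ap_int u -> admissible tau ->
  equipotentially_ap tau -> 0 < e ->
  relatively_dense [set r : R | exists q : int,
    [/\ forall t, `|f (t + r) - f t| < e,
        forall n, `|u (n + q) - u n| < e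
      & forall j, `|tau (j + q) - tau j - r| < e]].
Proof.
move=> fap uap tauadm tauap e0.
have [T [rep Hrep]] := finitely_colorable_net 0
  (finitely_colorableI (bohr_ap_int_colorable uap e0)
    (finitely_colorableI (equipotentially_ap_colorable tauap e0)
      (finitely_colorable_comp tau (bohr_ap_real_colorable fap e0)))).
have [B B0 HB] := equipotentially_ap_gap_bounded tauap.
pose C := \sum_k `|tau (rep k)|.
have C0 : 0 <= C by rewrite sumr_ge0.
exists (C + C + B); split; first lra.
move=> a; have [n /andP[n1 n2]] := admissible_locate (a + C) tauadm.
have [k [Hu [Htau Hf]]] := Hrep (n + 1).
(* p = n + 1 is the least index with a + C <= tau p, so that
   tau p <= a + C + B; p' is the representative of the color of p. *)
have := HB n; rewrite ler_norml => /andP[_ nB].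
have := @ler_norm_sum_term R T (tau \o rep) k.
rewrite -/C /= ler_norml => /andP[kC1 kC2].
set p := n + 1 in n2 nB Hu Htau Hf *; set p' := rep k in kC1 kC2 Hu Htau Hf *.
exists (tau p - tau p'); split.
  by rewrite /= in_itv/=; apply/andP; split; lra.
exists (p - p'); split=> [t|m|j].
- have := Hf (t - tau p'); rewrite subrK.
  by have -> : t - tau p' + tau p = t + (tau p - tau p') by lra.
- have := Hu (m - p'); rewrite subrK.
  by rewrite addrAC -addrA.
- have := Htau (j - p') 0; rewrite /tau_diff !add0r.
  have -> : p + (j - p') = j + (p - p') by exact: addrCA.
  have -> : p' + (j - p') = j by rewrite addrC subrK.
  by rewrite opprD opprK !opprD opprK addrACA.
Qed.

(** * The piecewise product f(t) u(n) *)

Section PiecewiseProduct.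
Variables (R : realType) (f : R -> R) (u tau : int -> R) (h : R -> R).
Hypothesis hdef : forall (n : int) (t : R),
  tau n < t <= tau (n + 1) -> h t = f t * u n.

(** Along any filter converging to t and eventually inside the n-th piece, h
    converges to the value at t of the n-th branch; the left, right and two-sided
    limits are all instances. *)
Lemma pieces_cvg (F : set_system R) {FF : Filter F} (n : int) (t : R) :
  continuous f -> F --> t -> (\forall x \near F, tau n < x <= tau (n + 1)) ->
  h x @[x --> F] --> f t * u n.
Proof.
move=> fc Ft nF.
have fg : {near F, (fun x => f x * u n) =1 h}.
  by near=> x; rewrite (@hdef n)//; near: x.
apply: cvg_trans (near_eq_cvg fg) _.
by apply: cvgMl; apply: cvg_comp Ft (fc t).
Unshelve. all: by end_near. Qed.

Lemma pieces_cvg_left (n : int) : continuous f -> tau n < tau (n + 1) ->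
  h x @[x --> (tau (n + 1))^'-] --> f (tau (n + 1)) * u n.
Proof.
move=> fc nn; apply: pieces_cvg => //; first exact: cvg_within.
near=> x; apply/andP; split; first by near: x; exact: nbhs_left_gt.
by near: x; exact: nbhs_left_le.
Unshelve. all: by end_near. Qed.

Lemma pieces_cvg_right (n : int) : continuous f -> tau n < tau (n + 1) ->
  h x @[x --> (tau n)^'+] --> f (tau n) * u n.
Proof.
move=> fc nn; apply: pieces_cvg => //; first exact: cvg_within.
near=> x; apply/andP; split; first by near: x; exact: nbhs_right_gt.
by near: x; exact: nbhs_right_le.
Unshelve. all: by end_near. Qed.

Lemma pieces_discontinuities : continuous f -> admissible tau ->
  discontinuities h `<=` range tau.
Proof.
move=> fc tauadm t ht; apply: contrapT => tNtau; apply: ht.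
have [n /andP[n1 n2]] := admissible_locate t tauadm.
have n3 : t < tau (n + 1).
  by rewrite lt_neqAle n2 andbT; apply/eqP => tn; apply: tNtau; exists (n + 1).
rewrite /prop_for /continuous_at (@hdef n) ?n1//.
apply: pieces_cvg => //.
have := @near_in_itvoo R (tau n) (tau (n + 1)) t.
rewrite in_itv/= n1 n3 => /(_ isT); apply: filterS => x.
by rewrite in_itv/= => /andP[-> /ltW].
Qed.

Lemma pieces_PC : continuous f -> admissible tau -> PC h.
Proof.
move=> fc tauadm; have [taui _ _] := tauadm.
have left j : h x @[x --> (tau j)^'-] --> f (tau j) * u (j - 1).
  have := @pieces_cvg_left (j - 1) fc; rewrite subrK; apply.
  by have := taui (j - 1); rewrite subrK.
exists tau; split=> //.
- exact: pieces_discontinuities.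
- move=> t /(pieces_discontinuities fc tauadm)[j _ <-].
  split; apply/cvg_ex; first by eexists; exact: left.
  by eexists; apply: pieces_cvg_right.
- move=> j; rewrite (@hdef (j - 1)) //.
  by have := taui (j - 1); rewrite !subrK lexx andbT.
Qed.

Lemma pieces_unif_continuous (e : R) : bohr_ap_real f -> bohr_ap_int u ->
  0 < e -> exists d : R, 0 < d /\ forall (j : int) (s t : R),
    s \in `]tau j, tau (j + 1)] -> t \in `]tau j, tau (j + 1)] ->
    `|s - t| < d -> `|h s - h t| < e.
Proof.
move=> fap uap e0.
have [B B0 HB] := bohr_ap_int_bounded uap.
have [d d0 Hd] := bohr_ap_unif_continuous fap (divr_gt0 e0 B0).
exists d; split=> // j s t; rewrite !in_itv/= => sj tj /Hd.
rewrite (hdef sj) (hdef tj) -mulrBl normrM ltr_pdivlMr//; apply: le_lt_trans.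
by rewrite ler_wpM2l.
Qed.

Lemma pieces_almost_periods (e : R) : bohr_ap_real f -> bohr_ap_int u ->
  admissible tau -> equipotentially_ap tau -> 0 < e ->
  relatively_dense (pc_almost_periods tau h e).
Proof.
move=> fap uap tauadm tauap e0.
have [A A0 HA] := bohr_ap_real_bounded fap.
have [B B0 HB] := bohr_ap_int_bounded uap.
have AB0 : 0 < A + B by lra.
pose d := Num.min e (e / (A + B)).
have d0 : 0 < d by rewrite lt_min e0 divr_gt0.
have de : d <= e by rewrite ge_min lexx.
have dAB : d * (A + B) <= e by rewrite -ler_pdivlMr// ge_min lexx orbT.
(* d <= e keeps t + r inside the piece of index n + q, and d (A + B) <= e
   controls the variation of the product. *)
have := common_almost_periods fap uap tauadm tauap d0.
apply: relatively_dense_sub => r [q [Hf Hu Htau]] t tfar.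
have [n /andP[n1 n2]] := admissible_locate t tauadm.
have h_tr : h (t + r) = f (t + r) * u (n + q).
  have := tfar n; have := tfar (n + 1); have := Htau n; have := Htau (n + 1).
  rewrite !ltr_norml => /andP[? ?] /andP[? ?].
  rewrite ler0_norm ?gtr0_norm; [|lra..] => ? ?.
  have sq : n + 1 + q = n + q + 1 by exact: addrAC.
  by apply: hdef; rewrite -sq; apply/andP; split; lra.
rewrite h_tr (@hdef n t) ?n1//.
have -> : f (t + r) * u (n + q) - f t * u n =
    (f (t + r) - f t) * u (n + q) + f t * (u (n + q) - u n).
  by rewrite mulrBl mulrBr addrA subrK.
rewrite (le_lt_trans (ler_normD _ _))// !normrM.
have H1 : `|f (t + r) - f t| * `|u (n + q)| < d * B.
  by rewrite (le_lt_trans (ler_wpM2l _ (HB _)))// ltr_pM2r.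
have H2 : `|f t| * `|u (n + q) - u n| < A * d.
  by rewrite (le_lt_trans (ler_wpM2r _ (HA _)))// ltr_pM2l.
rewrite (lt_le_trans _ dAB)// mulrDr addrC [d * A]mulrC ltrD//.
Qed.

End PiecewiseProduct.

Theorem theorem1p2 (R : realType) (f : R -> R) (u : int -> R) (tau : int -> R)
    (h : R -> R)
    (hf : bohr_ap_real f) (hu : bohr_ap_int u) (htau : wexler tau)
    (hdef : forall (n : int) (t : R),
       tau n < t <= tau (n + 1) -> h t = f t * u n) :
  PCAP h /\ PCAP_along tau h.
Proof.
have [tauadm _ tauap] := htau; have [fc _] := hf.
suff H : PCAP_along tau h by split=> //; exists tau.
split; first exact: pieces_PC hdef fc tauadm.
split.
- by split=> //; exact: pieces_discontinuities hdef fc tauadm.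
- by move=> e; exact: (pieces_unif_continuous hdef).
- by move=> e; exact: (pieces_almost_periods hdef).
Qed.
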